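(* Consider the interconnected system, the local optimal control problems $\mathrm{OCP}_i(t)$ and the closed loop described in the context, where the local dynamics satisfy the Lipschitz estimate stated there. For every feasible closed-loop execution (all problems $\mathrm{OCP}_i(t)$ feasible, inputs $u_i(t)=u_i^\star(0|t)$), every $t\in\mathbb Z_{\ge0}$, every $i$ and all $l=0,\dots,M$, $$\|x_i(t+l)-x_i^{\mathrm{nom},\star}(l|t)\|\le r_i^\star(l|t)+s_i(l|t),$$ where for $l=M$ the value $r_i^\star(M|t)$ is the auxiliary terminal radius $r_i^\star(M|t):=L_{i,1}r_i^\star(M-1|t)+\mathcal B_i(M-1|t)$.
   Context: Notation. $\|\cdot\|$ is the Euclidean norm, $\mathbb B_\Delta=\{e:\|e\|\le\Delta\}$, $\mathcal S\ominus\mathcal E=\{z: z+e\in\mathcal S\ \forall e\in\mathcal E\}$. For $v_{\mathcal N_i}=(v_j)_{j\in\mathcal N_i}$, $\|v_{\mathcal N_i}\|_{\mathcal N_i,\infty}=\max_{j\in\mathcal N_i}\|v_j\|$. Maxima over empty index sets are $0$. $\mathcal K$: continuous strictly increasing $\alpha:\mathbb R_{\ge0}\to\mathbb R_{\ge0}$ with $\alpha(0)=0$; $\mathcal K_\infty$: unbounded functions in $\mathcal K$; $\alpha<\mathrm{id}$ means $\alpha(s)<s$ for all $s>0$. System. $x_i(t+1)=g_i(x_i(t),x_{\mathcal N_i}(t),u_i(t))$, $i=1,\dots,\ell$, with constraint sets $\mathcal X_i\subseteq\mathbb R^{n_i}$, $\mathcal U_i\subseteq\mathbb R^{m_i}$,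 neighbor sets $\mathcal N_i\subset\{1,\dots,\ell\}\setminus\{i\}$, $x_{\mathcal N_i}=(x_j)_{j\in\mathcal N_i}$, $\mathcal X_{\mathcal N_i}=\prod_{j\in\mathcal N_i}\mathcal X_j$, $\mathcal X=\prod_i\mathcal X_i$, $\mathcal U=\prod_i\mathcal U_i$, $n=\sum_i n_i$, $g=(g_1,\dots,g_\ell)$, regarded as a map $g:\mathcal X\times\mathcal U\to\mathbb R^n$, $g(0,0)=0$; $g$ is $\mathcal K$-bounded: there are $\kappa_1,\kappa_2\in\mathcal K$ with $\|g(\xi,\mu)\|\le\kappa_1(\|\xi\|)+\kappa_2(\|\mu\|)$ on $\mathcal X\times\mathcal U$ (and likewise each $g_i$ on $\mathcal X_i\times\mathcal X_{\mathcal N_i}\times\mathcal U_i$). Lipschitz estimate: there are $L_{i,1},L_{i,2}>0$, $L_{i,3}\ge0$ with $$\|g_i(\xi_i,\xi_{\mathcal N_i},\mu_i)-g_i(\xi_i',\xi_{\mathcal N_i}',\mu_i')\|\le L_{i,1}\|\xi_i-\xi_i'\|+L_{i,2}\|\xi_{\mathcal N_i}-\xi'_{\mathcal N_i}\|_{\mathcal N_i,\infty}+L_{i,3}\|\mu_i-\mu_i'\|$$ on the constraint domain $\mathcal X_i\times\mathcal X_{\mathcal N_i}\times\mathcal U_i$. Design data. $M\ge2$ integer, $\lambda>0$, functions $W_i:\mathbb R^{n_i}\to\mathbb R_{\ge0}$ with $\underline\alpha_i(\|\xi_i\|)\le W_i(\xi_i)\le\overline\alpha_i(\|\xi_i\|)$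 for some $\underline\alpha_i,\overline\alpha_i\in\mathcal K_\infty$, and gains $\gamma_{ij}\in\mathcal K_\infty\cup\{0\}$ with $\gamma_{i_1i_2}\circ\gamma_{i_2i_3}\circ\cdots\circ\gamma_{i_ri_1}<\mathrm{id}$ for every cycle of distinct indices, $r=1,\dots,\ell$. $\mathcal G_i^\gamma=\{j:\gamma_{ij}\not\equiv0\}$. Packets. At time $t$ subsystem $i$ sends $(\bar x_i(l|t),\bar r_i(l|t))_{l=0}^{M-1}$ to the controllers of which it is a neighbor, where $\bar x_i(0|t)=x_i(t)$, $\bar r_i(0|t)=0$, and for $t\ge1$, $l=1,\dots,M-1$: $\bar x_i(l|t)=x_i^{\mathrm{nom},\star}(l+1|t-1)$, $\bar r_i(l|t)=r_i^\star(l+1|t-1)$. At $t=0$ packets (with nonnegative radii) are supplied by a feasible initialization procedure. At time $t$ controller $i$ knows the packets of all $j\in\mathcal N_i$ and the scalars $W_j(x_j(t))$, $j\in\mathcal G_i^\gamma$. Budget. $\mathcal B_i(l|t)=L_{i,2}\max_{j\in\mathcal N_i}\bar r_j(l|t)+d_i(l|t)$, $l=0,\dots,M-1$, where $d_i(l|t)=L_{i,2}\max_{j\in\mathcal N_i}\|\bar x_j(l|t)-\bar x_j(l+1|t-1)\|$ for $l\le M-2$ (for $t=0$, given nonnegative initialization values) and $d_i(M-1|t)=d_i^{\mathrm{ter}}(t)\ge0$ is prescribed. $\mathrm{OCP}_i(t)$: minimize over $(u_i(0|t),\dots,u_i(M-1|t))$ and $(r_i(1|t),\dots,r_i(M-1|t))$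 the cost $\sum_{l=0}^{M-1}W_i(x_i^{\mathrm{nom}}(l|t))+\lambda\sum_{l=1}^{M-1}r_i(l|t)$ subject to: $x_i^{\mathrm{nom}}(0|t)=x_i(t)$; $x_i^{\mathrm{nom}}(l+1|t)=g_i(x_i^{\mathrm{nom}}(l|t),\bar x_{\mathcal N_i}(l|t),u_i(l|t))$ and $u_i(l|t)\in\mathcal U_i$ for $l=0,\dots,M-1$; $r_i(l|t)\ge0$ and $x_i^{\mathrm{nom}}(l|t)\in\mathcal X_i\ominus\mathbb B_{r_i(l|t)}$ for $l=1,\dots,M-1$; $r_i(l+1|t)\ge L_{i,1}r_i(l|t)+\mathcal B_i(l|t)$ for $l=0,\dots,M-2$, with $r_i(0|t):=0$ fixed; and $W_i(x_i^{\mathrm{nom}}(M|t))\le\max_{j\in\mathcal G_i^\gamma}\gamma_{ij}(W_j(x_j(t)))$. Optimizers carry a star; existence of a minimizer is understood whenever an optimizer is invoked. $r_i^\star(0|t)=0$. Mismatch quantities. For $l=0,\dots,M-1$: $p_i(l|t)=\|x_{\mathcal N_i}(t+l)-\bar x_{\mathcal N_i}(l|t)\|_{\mathcal N_i,\infty}$, $\delta_i^u(l|t)=\|u_i^\star(0|t+l)-u_i^\star(l|t)\|$, $\eta_i(l|t)=\max\{L_{i,2}p_i(l|t)+L_{i,3}\delta_i^u(l|t)-\mathcal B_i(l|t),0\}$; $s_i(0|t)=0$, $s_i(l+1|t)=L_{i,1}s_i(l|t)+\eta_i(l|t)$. *)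

(* Defs.v *)
From HB Require Import structures.
From mathcomp Require Import all_boot all_order all_algebra.
From mathcomp Require Import all_classical all_reals all_analysis.

Set Implicit Arguments.
Unset Strict Implicit.
Unset Printing Implicit Defensive.

Import Order.TTheory GRing.Theory Num.Theory.
Import numFieldNormedType.Exports.

Local Open Scope classical_set_scope.
Local Open Scope ring_scope.

(* The library norm on matrices is the max norm, hence this definition. *)
Definition enorm (R : realType) (n : nat) (v : 'cV[R]_n) : R :=
  Num.sqrt (\sum_(k < n) v k ord0 ^+ 2).

Definition eball (R : realType) (n : nat) (D : R) : set 'cV[R]_n :=
  [set e | enorm e <= D].

Definition pontryagin_diff (V : zmodType) (S E : set V) : set V :=
  [set z | forall e, E e -> S (z + e)].

(* Comparison functions R>=0 -> R>=0 are represented by functions R -> R of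
   which only the restriction to [0, +oo[ matters. *)
Definition classK (R : realType) (a : R -> R) : Prop :=
  [/\ {within `[0, +oo[, continuous a},
      forall s t, 0 <= s -> s < t -> a s < a t
    & a 0 = 0].

Definition classKinf (R : realType) (a : R -> R) : Prop :=
  classK a /\ forall B, exists2 s, 0 <= s & B < a s.

Definition zero_gain (R : realType) (a : R -> R) : Prop :=
  forall s, 0 <= s -> a s = 0.

(* The subsystem indices 1, ..., ell are the elements of 'I_ell. The map g_i
   is only meaningful on X_i * X_{N_i} * U_i: its values elsewhere are never
   used, see [step]. *)
Record plant (R : realType) := Plant {
  ell : nat;
  xdim : 'I_ell -> nat;
  udim : 'I_ell -> nat;
  nbrs : 'I_ell -> {set 'I_ell};
  Xset : forall i, set 'cV[R]_(xdim i);
  Uset : forall i, set 'cV[R]_(udim i);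
  dyn : forall i, 'cV[R]_(xdim i) ->
        (forall j : {j | j \in nbrs i}, 'cV[R]_(xdim (val j))) ->
        'cV[R]_(udim i) -> 'cV[R]_(xdim i);
  lip1 : 'I_ell -> R;
  lip2 : 'I_ell -> R;
  lip3 : 'I_ell -> R
}.

Section Plant.
Variables (R : realType) (P : plant R).
Implicit Types i : 'I_(ell P).

Definition nstate i : Type :=
  forall j : {j | j \in nbrs i}, 'cV[R]_(xdim (val j)).

Definition to_nbrs i (x : forall j, 'cV[R]_(xdim j)) : nstate i :=
  fun j => x (val j).

Definition nnorm i (v : nstate i) : R :=
  \big[Num.max/0]_(j : {j | j \in nbrs i}) enorm (v j).

Definition nsub i (v w : nstate i) : nstate i := fun j => v j - w j.

Definition in_dom i (xi : 'cV[R]_(xdim i)) (xN : nstate i)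
    (ui : 'cV[R]_(udim i)) : Prop :=
  [/\ Xset xi, forall j, Xset (xN j) & Uset ui].

(* y = g_i(xi, xN, ui) for the partial map g_i with domain
   X_i * X_{N_i} * U_i; the equation entails that the point is in the domain. *)
Definition step i (xi : 'cV[R]_(xdim i)) (xN : nstate i)
    (ui : 'cV[R]_(udim i)) (y : 'cV[R]_(xdim i)) : Prop :=
  in_dom xi xN ui /\ y = dyn xi xN ui.

Definition global_g (x : forall i, 'cV[R]_(xdim i))
    (u : forall i, 'cV[R]_(udim i)) (i : 'I_(ell P)) : 'cV[R]_(xdim i) :=
  dyn (x i) (to_nbrs x) (u i).

Definition Kbounded : Prop :=
  exists k1 k2 : R -> R, [/\ classK k1, classK k2 &
    forall (x : forall i, 'cV[R]_(xdim i)) (u : forall i, 'cV[R]_(udim i)),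
      (forall i, Xset (x i)) -> (forall i, Uset (u i)) ->
      enorm (mxcol (global_g x u)) <= k1 (enorm (mxcol x)) + k2 (enorm (mxcol u))].

Definition local_Kbounded i : Prop :=
  exists k1 k2 k3 : R -> R, [/\ classK k1, classK k2, classK k3 &
    forall xi xN ui, @in_dom i xi xN ui ->
      enorm (dyn xi xN ui) <= k1 (enorm xi) + k2 (nnorm xN) + k3 (enorm ui)].

(* 0 in X_i and 0 in U_i are part of g(0, 0) = 0, as (0, 0) must be in the
   domain of g. *)
Definition plant_assumptions : Prop :=
  [/\ forall i, i \notin nbrs i,
      forall i, step (0 : 'cV[R]_(xdim i)) (fun=> 0) 0 0,
      Kbounded & forall i, local_Kbounded i].

Definition lipschitz_estimate : Prop :=
  forall i, [/\ 0 < lip1 i, 0 < lip2 i, 0 <= lip3 i &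
    forall xi xN ui xi' xN' ui',
      @in_dom i xi xN ui -> @in_dom i xi' xN' ui' ->
      enorm (dyn xi xN ui - dyn xi' xN' ui') <=
        lip1 i * enorm (xi - xi') + lip2 i * nnorm (nsub xN xN')
        + lip3 i * enorm (ui - ui')].

(* horizon = M, rweight = lambda, wfun i = W_i, gain i j = gamma_{ij}. *)
Record design := Design {
  horizon : nat;
  rweight : R;
  wfun : forall i, 'cV[R]_(xdim i) -> R;
  gain : 'I_(ell P) -> 'I_(ell P) -> R -> R
}.

(* gain_comp G i [:: i2; ...; ir] k is
   G_{i i2} o G_{i2 i3} o ... o G_{ir k}. *)
Fixpoint gain_comp (G : 'I_(ell P) -> 'I_(ell P) -> R -> R)
    (i : 'I_(ell P)) (c : seq 'I_(ell P)) (k : 'I_(ell P)) : R -> R :=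
  if c is j :: c' then G i j \o gain_comp G j c' k else G i k.

Definition small_gain (D : design) : Prop :=
  forall (i : 'I_(ell P)) (c : seq 'I_(ell P)), uniq (i :: c) ->
    forall s, 0 < s -> gain_comp (gain D) i c i s < s.

Definition design_assumptions (D : design) : Prop :=
  [/\ (2 <= horizon D)%N, 0 < rweight D,
      (forall i, (forall xi, 0 <= @wfun D i xi) /\
        exists a b : R -> R, [/\ classKinf a, classKinf b &
          forall xi, a (enorm xi) <= @wfun D i xi <= b (enorm xi)]),
      (forall i j, classKinf (gain D i j) \/ zero_gain (gain D i j))
    & small_gain D].

Definition gain_nbrs (D : design) (i : 'I_(ell P)) : {set 'I_(ell P)} :=
  finset (fun j => `[< ~ zero_gain (gain D i j) >]).

Section OCP.
Variables (D : design) (i : 'I_(ell P)).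
Variables (xi : 'cV[R]_(xdim i)) (xbN : nat -> nstate i) (Bud : nat -> R)
  (wmax : R).

(* The decision variables u(l), l < M, and r(l), 1 <= l < M, and the nominal
   states z(l), l <= M, are sequences indexed by nat; later entries are
   irrelevant. *)
Definition ocp_feasible (u : nat -> 'cV[R]_(udim i)) (r : nat -> R)
    (z : nat -> 'cV[R]_(xdim i)) : Prop :=
  [/\ z 0%N = xi /\ r 0%N = 0,
      forall l, (l < horizon D)%N -> step (z l) (xbN l) (u l) (z l.+1),
      forall l, (1 <= l < horizon D)%N ->
        0 <= r l /\ pontryagin_diff (@Xset _ P i) (eball (r l)) (z l),
      forall l, (l.+1 < horizon D)%N -> lip1 i * r l + Bud l <= r l.+1
    & wfun D (z (horizon D)) <= wmax].

Definition ocp_cost (r : nat -> R) (z : nat -> 'cV[R]_(xdim i)) : R :=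
  \sum_(0 <= l < horizon D) wfun D (z l) + rweight D * \sum_(1 <= l < horizon D) r l.

Definition ocp_optimal (u : nat -> 'cV[R]_(udim i)) (r : nat -> R)
    (z : nat -> 'cV[R]_(xdim i)) : Prop :=
  ocp_feasible u r z /\
  forall u' r' z', ocp_feasible u' r' z' -> ocp_cost r z <= ocp_cost r' z'.

End OCP.

(* q i l t stands for q_i(l|t), "at step l, predicted at time t". *)
Record execution := Execution {
  traj : forall i, nat -> 'cV[R]_(xdim i);
  ustar : forall i, nat -> nat -> 'cV[R]_(udim i);
  rstar : 'I_(ell P) -> nat -> nat -> R;
  xnom : forall i, nat -> nat -> 'cV[R]_(xdim i);
  xbar : forall i, nat -> nat -> 'cV[R]_(xdim i);
  rbar : 'I_(ell P) -> nat -> nat -> R;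
  dinit : 'I_(ell P) -> nat -> R;
  dter : 'I_(ell P) -> nat -> R
}.

Section Execution.
Variables (D : design) (E : execution).

Definition drift i (l t : nat) : R :=
  if l == (horizon D).-1 then dter E i t
  else if t is t'.+1 then
    lip2 i * \big[Num.max/0]_(j in nbrs i)
             enorm (@xbar E j l t - @xbar E j l.+1 t')
  else dinit E i l.

Definition budget i (l t : nat) : R :=
  lip2 i * \big[Num.max/0]_(j in nbrs i) rbar E j l t + drift i l t.

(* The optimal radii, extended to l = M by the auxiliary terminal radius. *)
Definition opt_radius i (l t : nat) : R :=
  if l == horizon D then
    lip1 i * rstar E i (horizon D).-1 t + budget i (horizon D).-1 t
  else rstar E i l t.

Definition terminal_bound i (t : nat) : R :=
  \big[Num.max/0]_(j in gain_nbrs D i) gain D i j (wfun D (traj E j t)).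

Definition feasible_execution : Prop :=
  [/\ forall i t, step (traj E i t) (to_nbrs (fun j => traj E j t))
                    (@ustar E i 0%N t) (traj E i t.+1),
      forall i t, ocp_optimal D (traj E i t)
                    (fun l => to_nbrs (fun j => @xbar E j l t))
                    (fun l => budget i l t) (terminal_bound i t)
                    (fun l => @ustar E i l t) (fun l => rstar E i l t)
                    (fun l => @xnom E i l t),
      forall i t, @xbar E i 0%N t = traj E i t /\ rbar E i 0%N t = 0,
      forall i l t, (1 <= l < horizon D)%N ->
        @xbar E i l t.+1 = @xnom E i l.+1 t /\
        rbar E i l t.+1 = opt_radius i l.+1 t
    & forall i, [/\ forall l, (l < horizon D)%N -> 0 <= rbar E i l 0%N,
                    forall l, (l.+1 < horizon D)%N -> 0 <= dinit E i l
                  & forall t, 0 <= dter E i t]].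

Definition pmis i (l t : nat) : R :=
  nnorm (nsub (@to_nbrs i (fun j => traj E j (t + l)%N))
              (@to_nbrs i (fun j => @xbar E j l t))).

Definition delta_u i (l t : nat) : R :=
  enorm (@ustar E i 0%N (t + l)%N - @ustar E i l t).

Definition eta_excess i (l t : nat) : R :=
  Num.max (lip2 i * pmis i l t + lip3 i * delta_u i l t - budget i l t) 0.

Fixpoint smis i (l t : nat) : R :=
  if l is l'.+1 then lip1 i * smis i l' t + eta_excess i l' t else 0.

End Execution.
End Plant.

(* Main.v *)
Require Import Defs.
From mathcomp Require Import all_boot all_order all_algebra.
From mathcomp Require Import all_reals.
From mathcomp Require Import lra.
Import Order.TTheory GRing.Theory Num.Theory.
Local Open Scope ring_scope.

(** By induction on l: one step of the Lipschitz estimate turns the error bound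
    at l into [L1 (r(l) + s(l)) + L2 p(l) + L3 du(l)]; the part of
    [L2 p(l) + L3 du(l)] covered by the budget [B(l)] is absorbed by the radius
    recursion, and the excess is [eta(l)], absorbed by the recursion of [s]. *)

Lemma enorm0 (R : realType) (n : nat) : enorm (0 : 'cV[R]_n) = 0.
Proof.
by rewrite /enorm big1 ?sqrtr0// => k _; rewrite mxE expr0n.
Qed.

(** For [l.+1 < horizon D] this is the radius constraint of the OCP; at [l.+1 = horizon D] it holds
    with equality by the choice of the terminal radius. *)
Lemma opt_radius_step (R : realType) (P : plant R) (D : design P)
    (E : execution P) (hE : feasible_execution D E)
    (i : 'I_(ell P)) (t l : nat) (hl : (l < horizon D)%N) :
  lip1 i * opt_radius D E i l t + budget D E i l t <= opt_radius D E i l.+1 t.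
Proof.
case: hE => _ /(_ i t) [[_ _ _ hr _] _] _ _ _.
rewrite /opt_radius (ltn_eqF hl); case: eqVneq => [<- //|neq].
by apply: hr; rewrite ltn_neqAle neq.
Qed.

Lemma le_budget_eta (R : realType) (P : plant R) (D : design P)
    (E : execution P) (i : 'I_(ell P)) (l t : nat) :
  lip2 i * pmis E i l t + lip3 i * delta_u E i l t
    <= budget D E i l t + eta_excess D E i l t.
Proof. by rewrite -lerBlDl /eta_excess le_max lexx. Qed.

Theorem lemma3 (R : realType) (P : plant R) (D : design P) (E : execution P)
    (hP : plant_assumptions P) (hL : lipschitz_estimate P)
    (hD : design_assumptions D) (hE : feasible_execution D E)
    (t : nat) (i : 'I_(ell P)) (l : nat) (hl : (l <= horizon D)%N) :
  enorm (traj E i (t + l)%N - xnom E i l t)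
    <= opt_radius D E i l t + smis D E i l t.
Proof.
have [hcl /(_ i t) [[[z0 r0] hz _ _ _] _] _ _ _] := hE.
have [L1_gt0 _ _ lip] := hL i.
elim: l hl => [_|l IHl hl].
  (* As [horizon D] is not 0, the radius at 0 is [rstar], not the terminal one. *)
  have [M_ge2 _ _ _ _] := hD.
  by rewrite /opt_radius (ltn_eqF (ltnW M_ge2)) r0 addn0 z0 subrr enorm0 addr0.
rewrite addnS.
(* Each [step] also yields membership in the domain, where alone the Lipschitz estimate holds. *)
have [dom_x ->] := hcl i (t + l)%N.
have [dom_z ->] := hz l hl.
apply: le_trans (lip _ _ _ _ _ _ dom_x dom_z) _.
have := ler_wpM2l (ltW L1_gt0) (IHl (ltnW hl)); rewrite mulrDr.
have := opt_radius_step _ _ _ _ hE i t l hl.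
have := le_budget_eta _ _ D E i l t.
rewrite /pmis /delta_u /=.
lra.
Qed.
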